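(* A simplicial surface $X$ is a face-transitive surface with $\mathrm{vf}(X)=(3,1)$ if and only if $H:=\lambda_X(\mathrm{Aut}(X))$ is a $(3,1)$-group of the face graph $\mathcal F(X)$ and the cycle double cover $\mathcal C^{(3,1)}(H)$ contains exactly the vertex-defining cycles of $X$.
   Context: A simplicial complex $X$ on a finite non-empty set $P$ is a non-empty family of subsets of $P$ closed under taking subsets; $X_i$ is the set of its elements of cardinality $i+1$; elements of $X_0,X_1,X_2$ are vertices, edges, faces. A simplicial surface is a simplicial complex $X$ such that: all inclusion-maximal elements have cardinality $3$; every edge lies in exactly two faces; and for every vertex $v$ the faces containing $v$ can be arranged in a cyclic sequence $u(v)=(F_1,\dots,F_n)$ (each once), the umbrella of $v$, with $|F_i\cap F_{i+1}|=2$ (subscripts mod $n$). Simplicial surfaces are assumed strongly connected (any two faces joined by a sequence of faces with consecutive ones sharing an edge). $\mathrm{Aut}(X)$ is the automorphism group (permutations of $X_0$ mapping faces to faces). $X$ is face-transitive if $\mathrm{Aut}(X)$ is transitive on $X_2$; then $\mathrm{vf}(X)=(a,s)$ with $a$ the number of $\mathrm{Aut}(X)$-orbits on $X_0$ and $s$ the order of the stabiliser in $\mathrm{Aut}(X)$ of a face. All graphs are finite, simple, undirected, connected; their elements are called nodes and arcs. The face graph $\mathcal F(X)$ has node set $X_2$, two faces being joined by an arc iff they share an edge; it is cubic. $\lambda_X:\mathrm{Aut}(X)\to\mathrm{Aut}(\mathcal F(X))$ is the injective homomorphism sending an automorphism to the permutation it induces on $X_2$. Each umbrella $u(v)$ is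 a cycle in $\mathcal F(X)$, called a vertex-defining cycle of $X$. Cycles are considered up to rotation and reversal. A cycle double cover of a cubic graph is a set of cycles such that every arc lies in exactly two of them. It is vertex-faithful if all its cycles are chordless and any two distinct cycles share at most one arc. Let $\mathcal G=(V,E)$ be a cubic node-transitive graph (i.e. $\mathrm{Aut}(\mathcal G)$ is transitive on $V$). A subgroup $H\le\mathrm{Aut}(\mathcal G)$ is a $(3,1)$-group of $\mathcal G$ if: (1) $H$ acts transitively on $V$ with $|H|=|V|$; (2) $H$ has exactly three orbits $E_1,E_2,E_3$ on $E$; and (3) with respect to the arc-colouring $\kappa$ with $\kappa(e)=i$ for $e\in E_i$, the set of all bi-coloured cycles is a vertex-faithful cycle double cover of $\mathcal G$; this cover is denoted $\mathcal C^{(3,1)}(H)$. A cycle is bi-coloured if exactly two colours occur on its arcs and consecutive arcs (cyclically) have different colours. *)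

(* Defs.v *)
From HB Require Import structures.
From mathcomp Require Import all_boot all_fingroup.

Set Implicit Arguments.
Unset Strict Implicit.
Unset Printing Implicit Defensive.

Local Open Scope group_scope.

(* A graph is an adjacency relation [e] on a finite type [T] of nodes. *)

Section Graphs.
Variables (T : finType) (e : rel T).
Implicit Types (x y : T) (u v : seq T) (H : {group {perm T}}).

Definition simple_connected_graph : Prop :=
  [/\ symmetric e, irreflexive e & forall x y, connect e x y].

Definition cubic : Prop := forall x, #|[set y | e x y]| = 3.

Definition arcs : {set {set T}} := [set [set p.1; p.2] | p : T * T & e p.1 p.2].

(* ['P^*] is the action of permutations on sets of points, so this is the group
   of the permutations of the nodes that map arcs to arcs. *)
Definition graph_aut : {group {perm T}} := 'N(arcs | 'P^*)%G.

Definition node_transitive : Prop := [transitive graph_aut, on [set: T] | 'P].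

(* A cycle is given by a node sequence [u], and [arc_seq u] lists its arcs in
   cyclic order.  A cycle up to rotation and reversal is represented by its set
   of arcs [cycle_arcs u]; see [cycle_arcs_rot], [cycle_arcs_rev] and
   [cycle_arcs_inj] below. *)
Definition is_cycle u : bool := [&& path.cycle e u, uniq u & 2 < size u].

Definition arc_seq u : seq {set T} := [seq [set x; next u x] | x <- u].

Definition cycle_arcs u : {set {set T}} := [set a in arc_seq u].

(* Repetition-free sequences have length at most #|T|, so bounding the length
   loses nothing. *)
Definition cycles : {set {set {set T}}} :=
  [set cycle_arcs u | u : #|T|.-bseq T & is_cycle u].

Definition cycle_double_cover (C : {set {set {set T}}}) : Prop :=
  C \subset cycles /\
  forall a, a \in arcs -> #|[set c in C | a \in c]| = 2.

(* [cover c] is the set of nodes of the cycle with set of arcs [c]. *)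
Definition chordless (c : {set {set T}}) : Prop :=
  forall a, a \in arcs -> a \subset cover c -> a \in c.

Definition vertex_faithful (C : {set {set {set T}}}) : Prop :=
  (forall c, c \in C -> chordless c) /\
  (forall c d, c \in C -> d \in C -> c != d -> #|c :&: d| <= 1).

Definition bicoloured (K : finType) (kappa : {set T} -> K) u : bool :=
  (#|kappa @: cycle_arcs u| == 2) &&
  path.cycle (fun a b => kappa a != kappa b) (arc_seq u).

Definition bicoloured_cycles (K : finType) (kappa : {set T} -> K) :
    {set {set {set T}}} :=
  [set cycle_arcs u | u : #|T|.-bseq T & is_cycle u && bicoloured kappa u].

(* The colour of an arc is its orbit under [H]: only the equality of colours
   matters, so the orbits need not be numbered. *)
Definition orbit_colouring H (a : {set T}) : {set {set T}} := orbit 'P^* H a.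

Definition cover31 H : {set {set {set T}}} :=
  bicoloured_cycles (orbit_colouring H).

Definition group31 H : Prop :=
  [/\ [/\ simple_connected_graph, cubic & node_transitive],
      H \subset graph_aut,
      [transitive H, on [set: T] | 'P] /\ #|H| = #|T|,
      #|orbit 'P^* H @: arcs| = 3
    & cycle_double_cover (cover31 H) /\ vertex_faithful (cover31 H)].

End Graphs.

Section GraphLemmas.
Variables (T : finType) (e : rel T).
Implicit Types (x y z w : T) (u v : seq T) (s : {perm T}).

Lemma set2_inj x y z w :
  [set x; y] = [set z; w] -> x = z /\ y = w \/ x = w /\ y = z.
Proof.
move=> E; have := set21 x y; have := set22 x y; have := set21 z w.
have := set22 z w; rewrite E -{1 2}E !inE.
by do 4![case/orP=> /eqP ?]; subst; tauto.
Qed.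

Lemma mem_arcs x y : symmetric e -> ([set x; y] \in arcs e) = e x y.
Proof.
move=> es; apply/imsetP/idP=> [[[z w] /=]|exy]; last by exists (x, y); rewrite ?inE.
by rewrite inE /= => ezw /set2_inj[[-> ->]|[-> ->]] //; rewrite es.
Qed.

Lemma graph_autP s : symmetric e ->
  s \in graph_aut e <-> forall x y, e (s x) (s y) = e x y.
Proof.
move=> es; have sE x y : ('P^* [set x; y] s)%act = [set s x; s y].
  by rewrite /= /setact imsetU1 imset_set1.
split=> [sN x y | sP]; first by rewrite -!mem_arcs // -sE (astabs_act _ sN).
rewrite !inE; apply/subsetP=> _ /imsetP[[x y] + ->]; rewrite !inE /= => exy.
by rewrite sE mem_arcs // sP.
Qed.

Lemma cyclesP (C : {set {set T}}) :
  reflect (exists2 u, is_cycle e u & C = cycle_arcs u) (C \in cycles e).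
Proof.
apply: (iffP imsetP) => [[u Hu ->]|[u Hu ->]].
  by exists u => //; rewrite inE in Hu.
have Hs : size u <= #|T|.
  by case/and3P: Hu => _ /card_uniqP<- _; apply: max_card.
by exists (Bseq Hs); rewrite ?inE.
Qed.

Lemma mem_cycle_arcsP u x y :
  [set x; y] \in cycle_arcs u <->
  x \in u /\ y = next u x \/ y \in u /\ x = next u y.
Proof.
rewrite inE; split=> [/mapP[z zu /set2_inj[[-> ->]|[-> ->]]]|]; try tauto.
case=> [[xu ->]|[yu ->]]; apply/mapP; first by exists x.
by exists y; rewrite // setUC.
Qed.

Lemma cycle_arcs_rot n u : uniq u -> cycle_arcs (rot n u) = cycle_arcs u.
Proof.
move=> Uu; apply/setP=> a; rewrite !inE /arc_seq.
rewrite (eq_map (g := fun x => [set x; next u x])); first by rewrite map_rot mem_rot.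
by move=> x; rewrite next_rot.
Qed.

Lemma cycle_arcs_rev u : uniq u -> cycle_arcs (rev u) = cycle_arcs u.
Proof.
move=> Uu; apply/setP=> a; rewrite !inE.
apply/mapP/mapP => -[x xu ->].
  exists (prev u x); first by rewrite mem_prev -mem_rev.
  by rewrite next_rev // next_prev // setUC.
exists (next u x); first by rewrite mem_rev mem_next.
by rewrite next_rev // prev_next // setUC.
Qed.

Lemma cycle_arcs_inj u v : is_cycle e u -> is_cycle e v ->
  cycle_arcs u = cycle_arcs v -> exists n, v = rot n u \/ v = rot n (rev u).
Proof.
have core (w : seq T) : uniq w -> uniq v -> 2 < size v -> cycle_arcs w = cycle_arcs v ->
    (exists2 x, x \in v & next v x = next w x) -> exists n, v = rot n w.
  move=> Uw Uv sv E [x0 x0v nx0].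
  have sub (a b : seq T) : uniq a -> cycle_arcs a = cycle_arcs b -> {subset a <= b}.
    move=> Ua Eab x xa.
    have : [set x; next a x] \in cycle_arcs b.
      by rewrite -Eab; apply: (proj2 (mem_cycle_arcsP _ _ _)); left.
    by move=> /(proj1 (mem_cycle_arcsP _ _ _)) [[]//|[yb ->]]; rewrite mem_next.
  have vw : v =i w by move=> x; apply/idP/idP; apply: sub.
  have szE : size v = size w by apply/perm_size/uniq_perm.
  have nn x : x \in v -> next v (next v x) != x.
    move=> xv; have [i r Er] := rot_to xv; rewrite -!(next_rot i Uv) Er.
    have: uniq (x :: r) by rewrite -Er rot_uniq.
    have: 2 < size (x :: r) by rewrite -Er size_rot.
    case: r {Er} => [|y [|z r]] //= _; rewrite !inE !negb_or -!andbA eqxx.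
    case/and5P=> nxy nxz _ _ _; rewrite eq_sym (eq_sym y) (negbTE nxy) ?eqxx /=.
    by rewrite ?eqxx ?(negbTE nxy) ?(negbTE nxz).
  have [i r Er] := rot_to x0v.
  have all_next n : let z := iter n (next v) x0 in
      z \in v /\ next v z = next w z.
    elim: n => [|n /= [zv nz]] //=; set z := iter _ _ _ in zv nz *.
    rewrite mem_next zv; split=> //.
    have: [set next v z; next v (next v z)] \in cycle_arcs w.
      by rewrite E; apply: (proj2 (mem_cycle_arcsP _ _ _)); left; rewrite mem_next.
    move=> /(proj1 (mem_cycle_arcsP _ _ _)) [[]//|[tw] /(congr1 (prev w))].
    rewrite prev_next // {1}nz prev_next // => zE.
    by have := nn _ zv; rewrite -zE eqxx.
  have fc (f : T -> T) p : fcycle f (x0 :: p) -> x0 :: p = traject f x0 (size p).+1.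
    by rewrite /= rcons_path => /andP[/fpathE Ep _]; congr (_ :: _).
  have x0w : x0 \in w by rewrite -vw.
  have [j q Eq] := rot_to x0w.
  have Evw : rot i v = rot j w.
    have := cycle_next Uv; rewrite -(rot_cycle i) Er => /fc->.
    have := cycle_next Uw; rewrite -(rot_cycle j) Eq => /fc->.
    have ->: (size q).+1 = (size r).+1.
      by have := size_rot i v; have := size_rot j w; rewrite Er Eq /= szE => -> ->.
    apply: (@eq_from_nth _ x0); rewrite !size_traject // => k kr.
    rewrite !nth_traject //; elim: k {kr} => //= k <-.
    by have [_ ->] := all_next k.
  by rewrite -(rotK i v) Evw /rotr rot_rot_add; eexists.
case/and3P=> _ Uu su; case/and3P=> _ Uv sv E.
case Ev: v sv => [|x v'] // sv; rewrite -Ev in sv *.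
have xv : x \in v by rewrite Ev mem_head.
have: [set x; next v x] \in cycle_arcs u.
  by rewrite E; apply: (proj2 (mem_cycle_arcsP _ _ _)); left.
move=> /(proj1 (mem_cycle_arcsP _ _ _)) [[_ nx]|[yu xE]].
  by have [n En] := core u Uu Uv sv E (ex_intro2 _ _ x xv nx); exists n; left.
have Ur : uniq (rev u) by rewrite rev_uniq.
have nx : next v x = next (rev u) x by rewrite next_rev // {2}xE prev_next.
have [n En] := core _ Ur Uv sv (etrans (cycle_arcs_rev Uu) E) (ex_intro2 _ _ x xv nx).
by exists n; right.
Qed.

End GraphLemmas.

Section Surfaces.
Variables (P : finType) (X : {set {set P}}).
Implicit Types (v : P) (A B : {set P}).

Definition simplicial_complex : Prop :=
  [/\ 0 < #|P|, X != set0 & forall A B, A \subset B -> B \in X -> A \in X].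

Definition simplices (i : nat) : {set {set P}} := [set A in X | #|A| == i.+1].

Definition edges := simplices 1.
Definition faces := simplices 2.

(* The elements [set v] of X_0 are identified with the points v. *)
Definition vertices : {set P} := [set v | [set v] \in simplices 0].

Definition face : finType := {F : {set P} | F \in faces}.

Definition umbrella v (u : seq face) : bool :=
  [&& uniq u, [forall F : face, (F \in u) == (v \in val F)]
    & path.cycle (fun F G : face => #|val F :&: val G| == 2) u].

Definition face_graph : rel face := fun F G =>
  (F != G) && [exists E in edges, (E \subset val F) && (E \subset val G)].

Definition simplicial_surface : Prop :=
  [/\ simplicial_complex,
      forall A, maxset [pred B | B \in X] A -> #|A| = 3,
      forall E, E \in edges -> #|[set F in faces | E \subset F]| = 2,
      forall v, v \in vertices -> exists u, umbrella v u
    & forall F G : face, connect face_graph F G].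

(* A permutation of the vertices is a permutation of P that fixes every other
   point of P. *)
Definition aut_complex : {group {perm P}} :=
  (Sym vertices :&: 'N(faces | 'P^*))%G.

Definition face_transitive : Prop := [transitive aut_complex, on faces | 'P^*].

(* For a face-transitive surface the second clause does not depend on the
   choice of the face. *)
Definition has_vf (a s : nat) : Prop :=
  #|orbit 'P aut_complex @: vertices| = a /\
  forall F, F \in faces -> #|'C_aut_complex[F | 'P^*]| = s.

(* The domain of this morphism is the stabiliser of [faces] in {perm P}, which
   contains [aut_complex]; see [lambdaE] below. *)
Definition lambda := [morphism of actperm (subaction face ('P^*))].

Definition vertex_defining_cycles : {set {set {set face}}} :=
  [set cycle_arcs u | u : #|face|.-bseq face & [exists v in vertices, umbrella v u]].

Lemma lambdaE s (F : face) :
  s \in aut_complex -> val (lambda s F) = s @: val F.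
Proof.
rewrite /aut_complex /= => /setIP[_ nFs].
have sD : s \in subact_dom (fun F => F \in faces) 'P^*.
  by rewrite /subact_dom (_ : [set x | _] = faces) //; apply/setP=> A; rewrite inE.
by rewrite actpermE /= val_subact sD.
Qed.

End Surfaces.

Arguments face_graph {P} X _ _.

(* Main.v *)
(* For a face F and a vertex v of F there is a unique face [across F v] meeting F
   in the edge opposite to v; let c(F, v) be the colour (the H-orbit) of the arc
   joining them.  Assume Aut(X) transitive on faces.  Both sides of the
   equivalence amount, besides regularity of H, to the two conditions
   - c(F, -) is injective on the vertices of F, and
   - c(F, v) depends only on v, not on the face F containing it.
   If there are three vertex orbits, then c(F, v) is determined by the orbit of v
   and conversely, whence both conditions.  Under these conditions a bicoloured
   cycle never crosses an arc of the third colour k, hence stays around the vertex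
   opposite to such arcs, so it is the umbrella of that vertex.  Conversely, if the
   umbrellas are bicoloured, then c(F, v) is the colour absent from the umbrella
   of v. *)
Require Import Defs.
From mathcomp Require Import all_boot all_fingroup.

Set Implicit Arguments.
Unset Strict Implicit.
Unset Printing Implicit Defensive.

(** * Preliminaries on small sets and on cycles *)

Lemma set2_of_cards (T : finType) (A B : {set T}) x :
  #|A| = 3 -> #|B| = 3 -> x \in A -> x \notin B ->
  (#|A :&: B| == 2) = (A :\ x \subset B).
Proof.
move=> cA cB xA xB.
have cAx : #|A :\ x| = 2 by have := cardsD1 x A; rewrite xA cA => -[].
have sub : A :&: B \subset A :\ x.
  apply/subsetP=> y /setIP[yA yB]; rewrite !inE yA andbT.
  by apply: contraNneq xB => <-.
apply/idP/idP => [/eqP cAB|sAxB].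
  have/eqP<- : A :&: B == A :\ x by rewrite eqEcard sub cAx cAB.
  exact: subsetIr.
have/eqP-> : A :&: B == A :\ x by rewrite eqEsubset sub subsetI subD1set.
by rewrite cAx.
Qed.

Section CycleNeighbours.
Variables (T : finType) (e : rel T).
Implicit Types (x y : T) (u : seq T).

(** Equality would give [next u (next u x) = x], impossible in a repetition-free cycle of length at
    least three. *)
Lemma next_neq_prev u x : is_cycle e u -> x \in u -> next u x != prev u x.
Proof.
case/and3P=> _ Uu su xu; apply/eqP=> /(congr1 (next u)); rewrite next_prev //.
have [i r Er] := rot_to xu; rewrite -!(next_rot i Uu) Er.
have : uniq (x :: r) by rewrite -Er rot_uniq.
have : 2 < size (x :: r) by rewrite -Er size_rot.
case: r {Er} => [|y [|z r]] //= _; rewrite !inE !negb_or -!andbA eqxx.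
case/and5P=> nxy nxz _ _ _; rewrite eq_sym (negbTE nxy) eqxx => E.
by rewrite -E eqxx in nxz.
Qed.

Lemma bicoloured_cyclesP (K : finType) (kappa : {set T} -> K) (C : {set {set T}}) :
  reflect (exists u, [/\ is_cycle e u, bicoloured kappa u & C = cycle_arcs u])
    (C \in bicoloured_cycles e kappa).
Proof.
apply: (iffP imsetP) => [[u]|[u [cu bu ->]]].
  by rewrite inE => /andP[cu bu] ->; exists u.
have su : size u <= #|T|.
  by case/and3P: cu => _ /card_uniqP<- _; apply: max_card.
by exists (Bseq su); rewrite ?inE ?cu.
Qed.

End CycleNeighbours.

Section Surface.
Variables (P : finType) (X : {set {set P}}).
Hypothesis hX : simplicial_surface X.
Implicit Types (v w : P) (F G : face X) (u : seq (face X)) (s : {perm P}).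

Local Notation fg := (face_graph X).

(** * Faces, their vertices and adjacency in the face graph *)

Lemma face_mem F : val F \in X.
Proof. by have := valP F; rewrite inE => /andP[]. Qed.

Lemma card_face F : #|val F| = 3.
Proof. by have := valP F; rewrite inE => /andP[_ /eqP]. Qed.

Lemma face_vertex F v : v \in val F -> v \in vertices X.
Proof.
case: hX => -[_ _ dX] _ _ _ _ vF; rewrite !inE cards1 eqxx andbT.
by apply: dX (face_mem F); rewrite sub1set.
Qed.

Lemma simplex_face A : A \in X -> exists F, A \subset val F.
Proof.
case: hX => _ maxX _ _ _ AX.
have [B mB sAB] := @maxset_exists _ [pred B | B \in X] A AX.
have BX : B \in X by case/maxsetP: mB.
have BF : B \in faces X by rewrite inE BX maxX.
by exists (Sub B BF).
Qed.

Lemma vertex_face v : v \in vertices X -> exists F, v \in val F.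
Proof. by rewrite !inE => /andP[/simplex_face[F]]; rewrite sub1set; exists F. Qed.

Lemma face_exists : exists F : face X, true.
Proof.
by case: hX => -[_ /set0Pn[A /simplex_face[F _]] _] _ _ _ _; exists F.
Qed.

Lemma face_graphE F G : fg F G = (#|val F :&: val G| == 2).
Proof.
have fI H : (#|val F :&: val H| == 2) -> val F :&: val H \in edges X.
  case: hX => -[_ _ dX] _ _ _ _ c2; rewrite inE c2 andbT.
  exact: dX (subsetIl _ _) (face_mem F).
apply/andP/idP => [[nFG /existsP[E /and3P[]]]|c2].
  rewrite inE => /andP[_ /eqP cE] sEF sEG.
  have : E \subset val F :&: val G by rewrite subsetI sEF.
  move/subset_leq_card; rewrite cE leq_eqVlt eq_sym => /orP[//|c3].
  have eI : val F :&: val G == val F by rewrite eqEcard subsetIl card_face.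
  have eI' : val F :&: val G == val G by rewrite eqEcard subsetIr card_face.
  by case/eqP: nFG; apply: val_inj; rewrite -(eqP eI) {1}(eqP eI').
split; last by apply/existsP; exists (val F :&: val G); rewrite fI // subsetIl subsetIr.
by apply: contraTneq c2 => ->; rewrite setIid card_face.
Qed.

Lemma face_graph_sym : symmetric fg.
Proof. by move=> F G; rewrite !face_graphE setIC. Qed.

Lemma face_graph_irr : irreflexive fg.
Proof. by move=> F; rewrite face_graphE setIid card_face. Qed.

Lemma face_graph_simple : simple_connected_graph fg.
Proof.
split; [exact: face_graph_sym | exact: face_graph_irr |].
by case: hX.
Qed.

(** * The neighbour of a face opposite to one of its vertices *)

(** The default [F] keeps the function total; for [v] in [F] the choice succeeds and is unique by
    [across_ex]. *)
Definition across F v : face X :=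
  odflt F [pick G | fg F G && (v \notin val G)].

(** The edge [val F :\ v] lies in exactly one face besides [F], and the neighbours of [F] avoiding
    [v] are the faces other than [F] that contain this edge. *)
Lemma across_ex F v : v \in val F -> exists G,
  forall G', (fg F G' && (v \notin val G')) = (G' == G).
Proof.
case: hX => -[_ _ dX] _ eX _ _ vF.
have EX : val F :\ v \in edges X.
  rewrite inE (dX _ _ (subD1set _ _) (face_mem F)) /=.
  by have := cardsD1 v (val F); rewrite vF card_face add1n => -[<-].
have fS H : (fg F H && (v \notin val H)) = (H != F) && (val F :\ v \subset val H).
  rewrite face_graphE; case: (boolP (v \in val H)) => vH /=.
    rewrite andbF; apply/esym/negbTE; rewrite negb_and negbK -implyNb.
    apply/implyP=> nHF; apply: contraNN nHF => sub; rewrite -val_eqE eq_sym eqEcard !card_face leqnn andbT.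
    by rewrite -(setD1K vF) subUset sub1set vH.
  rewrite andbT (set2_of_cards _ _ vF vH) ?card_face //.
  by case: eqP => // HF; rewrite HF vF in vH.
have := eX _ EX; set S := [set _ in _ | _] => cS.
have FS : val F \in S by rewrite inE (valP F) subD1set.
have : #|S :\ val F| == 1 by have := cardsD1 (val F) S; rewrite FS cS add1n => -[<-].
case/cards1P=> A eA; have : A \in S :\ val F by rewrite eA set11.
case/setD1P=> _; rewrite inE => /andP[AF _]; exists (Sub A AF) => H.
rewrite fS -!val_eqE; transitivity (val H \in [set A]); last by rewrite in_set1.
by rewrite -eA in_setD1 inE (valP H).
Qed.

Lemma acrossP F v G : v \in val F -> (fg F G && (v \notin val G)) = (G == across F v).
Proof.
move=> vF; have [H HP] := across_ex vF; rewrite HP; congr (_ == _).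
rewrite /across; case: pickP => [H'|/(_ H)]; first by rewrite HP => /eqP.
by rewrite HP eqxx.
Qed.

Lemma across_adj F v : v \in val F -> fg F (across F v).
Proof. by move=> vF; have := acrossP (across F v) vF; rewrite eqxx => /andP[]. Qed.

Lemma across_notin F v : v \in val F -> v \notin val (across F v).
Proof. by move=> vF; have := acrossP (across F v) vF; rewrite eqxx => /andP[]. Qed.

Lemma across_in F v w : v \in val F -> w \in val F -> (w \in val (across F v)) = (w != v).
Proof.
move=> vF wF; apply/idP/idP => [|nwv].
  by apply: contraTneq => ->; apply: across_notin.
have := across_adj vF; rewrite face_graphE.
rewrite (set2_of_cards _ _ vF (across_notin vF)) ?card_face // => /subsetP-> //.
by rewrite !inE nwv.
Qed.

Lemma across_inj F : {in val F &, injective (across F)}.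
Proof.
move=> v w vF wF E; apply/eqP; have := across_in vF wF.
by rewrite E (negbTE (across_notin wF)) eq_sym => /esym/negbFE.
Qed.

Lemma adj_across F G : fg F G -> exists2 v, v \in val F & G = across F v.
Proof.
move=> FG; have [sub|/subsetPn[v vF vG]] := boolP (val F \subset val G).
  by move: FG; rewrite face_graphE (setIidPl sub) card_face.
by exists v => //; apply/eqP; rewrite -acrossP // FG.
Qed.

Lemma across_imset F : [set G | fg F G] = [set across F v | v in val F].
Proof.
apply/setP=> G; rewrite inE; apply/idP/imsetP => [/adj_across[v]|[v vF ->]].
  by exists v.
exact: across_adj.
Qed.

Lemma face_graph_cubic : cubic fg.
Proof. by move=> F; rewrite across_imset card_in_imset ?card_face //; apply: across_inj. Qed.

(** * Stars of vertices and umbrellas *)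

(** This is the arc set of the umbrella of [v], described without a cyclic order. *)
Definition star v : {set {set face X}} :=
  [set a in arcs fg | [forall F in a, v \in val F]].

Lemma star_arc v F G :
  ([set F; G] \in star v) = [&& fg F G, v \in val F & v \in val G].
Proof.
rewrite inE mem_arcs; last exact: face_graph_sym.
case: (fg F G) => //=; apply/forall_inP/andP => [vA|[vF vG] H].
  by rewrite !vA ?set21 ?set22.
by rewrite !inE => /orP[]/eqP->.
Qed.

Lemma starP v a : reflect
  (exists F G, [/\ fg F G, v \in val F, v \in val G & a = [set F; G]]) (a \in star v).
Proof.
apply: (iffP idP) => [aS|[F [G [FG vF vG ->]]]]; last by rewrite star_arc FG vF.
have /imsetP[[F G] _ /= aE] : a \in arcs fg by move: aS; rewrite inE => /andP[].
by move: aS; rewrite aE star_arc => /and3P[FG vF vG]; exists F, G.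
Qed.

Lemma star_across v F w : v \in val F -> w \in val F ->
  ([set F; across F w] \in star v) = (v != w).
Proof. by move=> vF wF; rewrite star_arc across_adj // vF across_in. Qed.

Lemma face_other F v : v \in val F -> exists2 w, w \in val F & w != v.
Proof.
move=> vF; have : 0 < #|val F :\ v|.
  by have := cardsD1 v (val F); rewrite vF card_face add1n => -[<-].
by case/card_gt0P=> w /setD1P[nwv wF]; exists w.
Qed.

(** At a face containing both vertices, the arc opposite to [w] lies in [star v] whenever [v != w],
    but never in [star w]. *)
Lemma star_inj : {in vertices X &, injective star}.
Proof.
move=> v w /vertex_face[F vF] _ E; apply/eqP.
have [x xF nxv] := face_other vF.
have : [set F; across F x] \in star w by rewrite -E star_across // eq_sym.
rewrite star_arc => /and3P[_ wF _].
by have := star_across vF wF; rewrite E star_across // eqxx => /esym/negbFE.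
Qed.

(** A face at [v] has just two neighbours at [v], those opposite to its other two vertices. *)
Lemma star_neighbours v F G1 G2 G : v \in val F ->
  [/\ fg F G1, fg F G2, fg F G & G1 != G2] ->
  [/\ v \in val G1, v \in val G2 & v \in val G] -> G = G1 \/ G = G2.
Proof.
move=> vF [/adj_across[a aF ->] /adj_across[b bF ->] /adj_across[c cF ->]] nab.
rewrite !across_in // => -[va vb vc].
have {}nab : a != b by apply: contraNneq nab => ->.
have : c \in [set a; b].
  suff/eqP-> : [set a; b] == val F :\ v by rewrite !inE eq_sym vc cF.
  rewrite eqEcard cards2 nab subUset !sub1set !inE aF bF eq_sym va eq_sym vb /=.
  by have := cardsD1 v (val F); rewrite vF card_face add1n => -[<-].
by rewrite !inE => /orP[]/eqP->; [left | right].
Qed.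

Lemma cycle_neighbours v u F G : is_cycle fg u -> {in u, forall F, v \in val F} ->
  F \in u -> fg F G -> v \in val G -> G = next u F \/ G = prev u F.
Proof.
move=> cu vu Fu FG vG; have /and3P[cy _ _] := cu.
apply: (star_neighbours (vu _ Fu)); last by split=> //; apply: vu; rewrite ?mem_next ?mem_prev.
split=> //; first exact: next_cycle; last exact: next_neq_prev cu Fu.
by rewrite face_graph_sym; apply: prev_cycle.
Qed.

Lemma mem_umbrella v u F : umbrella v u -> (F \in u) = (v \in val F).
Proof. by case/and3P=> _ /forallP/(_ F)/eqP. Qed.

(** For the length bound: a face at [v] and its neighbours opposite to its other two vertices are
    three distinct faces at [v]. *)
Lemma umbrella_is_cycle v u : v \in vertices X -> umbrella v u -> is_cycle fg u.
Proof.
move=> /vertex_face[F vF] umb; have /and3P[Uu _ cu] := umb; apply/and3P; split=> //.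
  by rewrite (eq_cycle (e' := fun F G => #|val F :&: val G| == 2)) // => ? ?; apply: face_graphE.
have [w wF nwv] := face_other vF.
have [x] : exists x, x \in val F :\ v :\ w.
  apply/card_gt0P; have := cardsD1 v (val F); rewrite vF card_face add1n => -[].
  by rewrite (cardsD1 w) !inE wF nwv add1n => -[<-].
case/setD1P=> nxw /setD1P[nxv xF].
have nF z : z \in val F -> F != across F z.
  by move=> zF; apply: contraTneq (across_adj zF) => <-; rewrite face_graph_irr.
apply: (@uniq_leq_size _ [:: F; across F w; across F x]).
  rewrite /= !inE !negb_or !nF //= andbT.
  by apply: contra nxw => /eqP/across_inj-> //.
move=> G; rewrite !inE (mem_umbrella _ umb) => /or3P[]/eqP-> //.
  by rewrite across_in // eq_sym.
by rewrite across_in // eq_sym.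
Qed.

(* A cycle through faces at [v] is closed under passing to the next face of the
   umbrella of [v], so it contains all faces at [v]. *)
Lemma cycle_arcs_star v u : v \in vertices X -> is_cycle fg u ->
  {in u, forall F, v \in val F} -> cycle_arcs u = star v.
Proof.
move=> vX cu vu; have [um umb] : exists u, umbrella v u by case: hX => _ _ _ uX _; apply: uX.
have cum := umbrella_is_cycle vX umb; have /and3P[cym Um _] := cum.
have [F0 F0u] : exists F0, F0 \in u by case: u cu {vu} => [|F0 ?] //; exists F0; rewrite mem_head.
have closed F : F \in u -> next um F \in u.
  move=> Fu; have Fum : F \in um by rewrite (mem_umbrella _ umb) vu.
  have vn : v \in val (next um F) by rewrite -(mem_umbrella _ umb) mem_next.
  have := cycle_neighbours cu vu Fu (next_cycle cym Fum) vn.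
  by case=> ->; rewrite ?mem_next ?mem_prev.
have all_u F : v \in val F -> F \in u.
  rewrite -(mem_umbrella _ umb).
  have F0um : F0 \in um by rewrite (mem_umbrella _ umb) vu.
  rewrite -(fconnect_cycle (cycle_next Um) F0um) => /iter_findex<-.
  by elim: (findex _ _ _) => //= n; apply: closed.
have /and3P[cy Uu _] := cu.
apply/setP=> a; apply/idP/starP => [|[F [G [FG vF vG ->]]]].
  rewrite inE => /mapP[F Fu ->]; exists F, (next u F).
  by split; rewrite ?next_cycle //; apply: vu; rewrite ?mem_next.
apply/mem_cycle_arcsP; rewrite !all_u //.
have [->|->] := cycle_neighbours cu vu (all_u _ vF) FG vG; first by left.
by right; rewrite next_prev.
Qed.

(** This replaces umbrellas, which are only known to exist, by arc sets that depend on the vertex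
    alone. *)
Lemma vertex_defining_cycles_star : vertex_defining_cycles X = [set star v | v in vertices X].
Proof.
apply/setP=> c; apply/imsetP/imsetP => [[u]|[v vX ->]].
  rewrite inE => /existsP[v /andP[vX umb]] ->; exists v => //.
  apply: cycle_arcs_star (umbrella_is_cycle vX umb) _ => // F.
  by rewrite (mem_umbrella _ umb).
have [u umb] : exists u, umbrella v u by case: hX => _ _ _ uX _; apply: uX.
have cu := umbrella_is_cycle vX umb; have /and3P[_ Uu _] := cu.
have su : size u <= #|face X| by move/card_uniqP: Uu => <-; apply: max_card.
exists (Bseq su); first by rewrite inE; apply/existsP; exists v; rewrite vX.
by apply/esym/cycle_arcs_star => // F; rewrite (mem_umbrella _ umb).
Qed.

(** * The stars as a vertex-faithful cycle double cover *)

(** The stars through the arc between [F] and [G] are those of the two vertices in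
    [val F :&: val G], distinct by [star_inj]. *)
Lemma stars_double_cover : cycle_double_cover fg [set star v | v in vertices X].
Proof.
split.
  apply/subsetP=> c; rewrite -vertex_defining_cycles_star => /imsetP[u].
  rewrite inE => /existsP[v /andP[vX umb]] ->; apply/cyclesP.
  by exists u => //; apply: umbrella_is_cycle umb.
move=> a /imsetP[[F G]]; rewrite inE /= => FG ->.
have FGX : {subset val F :&: val G <= vertices X}.
  by move=> v /setIP[vF _]; apply: face_vertex vF.
transitivity #|star @: (val F :&: val G)|; last first.
  rewrite card_in_imset; first by apply/eqP; rewrite -face_graphE.
  by move=> v w vI wI; apply: star_inj; apply: FGX.
congr #|pred_of_set _|; apply/setP=> c; rewrite inE.
apply/andP/imsetP => [[/imsetP[v vX ->]]|[v vI ->]].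
  by rewrite star_arc => /and3P[_ vF vG]; exists v; rewrite ?inE ?vF.
rewrite star_arc FG; move: (vI) => /setIP[-> ->]; split=> //.
by apply: imset_f; apply: FGX.
Qed.

(** All nodes of [star v] contain [v], so an arc between two of them is in the star. An arc common
    to two stars joins the two faces that contain both vertices, which determines it. *)
Lemma stars_vertex_faithful : vertex_faithful fg [set star v | v in vertices X].
Proof.
split=> [_ /imsetP[v vX ->] a aA /subsetP sub|_ _ /imsetP[v vX ->] /imsetP[w wX ->] nvw].
  rewrite inE aA; apply/forall_inP=> F /sub /bigcupP[b /starP[F1 [F2 [_ v1 v2 ->]]]].
  by rewrite !inE => /orP[]/eqP->.
have {}nvw : v != w by apply: contraNneq nvw => ->.
have memE a : a \in star v :&: star w ->
    val @: a = [set F in faces X | [set v; w] \subset F].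
  case/setIP=> /starP[F [G [FG vF vG ->]]]; rewrite star_arc => /and3P[_ wF wG].
  have EX : [set v; w] \in edges X.
    rewrite inE cards2 nvw andbT; case: hX => -[_ _ dX] _ _ _ _.
    by apply: dX (face_mem F); rewrite subUset !sub1set vF.
  apply/eqP; rewrite eqEcard; apply/andP; split.
    apply/subsetP=> A; rewrite imsetU1 imset_set1 [A \in [set _ in _ | _]]inE => /set2P[]->.
      by rewrite (valP F) subUset !sub1set vF.
    by rewrite (valP G) subUset !sub1set vG.
  case: hX => _ _ /(_ _ EX) -> _ _; rewrite (card_imset _ val_inj) cards2.
  by case: eqP FG => // ->; rewrite face_graph_irr.
apply/card_le1_eqP=> a b /memE Ea /memE Eb.
by apply: (imset_inj val_inj); rewrite Ea Eb.
Qed.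

(** * The action of automorphisms on the face graph *)

Local Notation Aut := (aut_complex X).
Local Notation lam := (lambda X).
Local Notation H := (lam @* Aut)%G.

Lemma lambda_imageP h : reflect (exists2 s, s \in Aut & h = lam s) (h \in H).
Proof.
apply: (iffP idP) => [/morphimP[s _ sA ->]|[s sA ->]]; first by exists s.
rewrite mem_morphim //.
case/setIP: sA => _ nFs; rewrite /= /subact_dom.
by rewrite (_ : [set x | _] = faces X) //; apply/setP=> A; rewrite inE.
Qed.

Lemma mem_lambda s F v : s \in Aut -> (s v \in val (lam s F)) = (v \in val F).
Proof. by move=> sA; rewrite lambdaE // mem_imset //; apply: perm_inj. Qed.

Lemma lambda_adj s F G : s \in Aut -> fg (lam s F) (lam s G) = fg F G.
Proof.
move=> sA; rewrite !face_graphE !lambdaE // -imsetI ?card_imset //; first exact: perm_inj.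
by move=> ? ? _ _; apply: perm_inj.
Qed.

Lemma lambda_across s F v : s \in Aut -> v \in val F ->
  lam s (across F v) = across (lam s F) (s v).
Proof.
move=> sA vF; apply/eqP; rewrite -acrossP ?mem_lambda //.
by rewrite lambda_adj // across_adj // across_notin.
Qed.

Lemma lambda_inj : {in Aut &, injective lam}.
Proof.
move=> s t sA tA E; apply/permP=> v.
have [vX|nvX] := boolP (v \in vertices X); last first.
  have fixv r : r \in Aut -> r v = v.
    by case/setIP; rewrite inE => /out_perm-> .
  by rewrite !fixv.
have [F vF] := vertex_face vX; apply/eqP/negPn/negP=> nst.
have svF : s v \in val (lam s F) by rewrite mem_lambda.
have tvF : t v \in val (lam s F) by rewrite E mem_lambda.
(* If [s v] and [t v] differ, the neighbour of the common image opposite to [t v] contains [s v];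
   but it is the image of [across F v], which omits [s v]. *)
have := across_in tvF svF; rewrite nst {1}E -lambda_across // -E.
by rewrite mem_lambda // (negbTE (across_notin vF)).
Qed.

Lemma card_lambda_image : #|H| = #|Aut|.
Proof.
rewrite -(card_in_imset lambda_inj); apply: eq_card => h.
by apply/lambda_imageP/imsetP.
Qed.

(** Common form of transitivity of [Aut] on [faces X] and of its image on the nodes of the face
    graph. *)
Definition transitive_on_faces := forall F G, exists2 s, s \in Aut & lam s F = G.

Lemma face_transitiveP : face_transitive X <-> transitive_on_faces.
Proof.
split=> [tr F G|tr].
  have [s sA E] := atransP2 tr (valP F) (valP G).
  by exists s => //; apply: val_inj; rewrite lambdaE.
have [F _] := face_exists; apply/imsetP; exists (val F); first exact: valP.
apply/setP=> A; apply/idP/imsetP => [AF|[s /setIP[_ sN] ->]].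
  have [s sA /(congr1 val)] := tr F (Sub A AF).
  by rewrite lambdaE // => E; exists s => //; apply: esym E.
by rewrite (astabs_act _ sN) (valP F).
Qed.

Lemma lambda_transitiveP :
  [transitive H, on [set: face X] | 'P] <-> transitive_on_faces.
Proof.
split=> [tr F G|tr].
  have [_ /lambda_imageP[s sA ->] E] := atransP2 tr (in_setT F) (in_setT G).
  by exists s.
have [F _] := face_exists; apply/imsetP; exists F => //.
apply/esym/setP=> G; rewrite inE; have [s sA <-] := tr F G.
by apply/orbitP; exists (lam s) => //; apply/lambda_imageP; exists s.
Qed.

(** Orbit-stabiliser: [#|H|], which equals [#|Aut|], is the number of faces times the order of any
    face stabiliser. *)
Lemma stabilisers_trivialP : transitive_on_faces ->
  (forall A, A \in faces X -> #|('C_Aut[A | 'P^*])%g| = 1) <-> #|H| = #|face X|.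
Proof.
move=> /face_transitiveP tr.
have cF A : A \in faces X -> #|face X| * #|('C_Aut[A | 'P^*])%g| = #|H|.
  by move=> AF; rewrite card_lambda_image card_sig -(card_orbit_stab 'P^* (aut_complex X) A) (atransP tr _ AF).
have f0 : 0 < #|face X| by have [F _] := face_exists; apply/card_gt0P; exists F.
have [F _] := face_exists; split=> [st|cH A /cF].
  by rewrite -(cF _ (valP F)) st ?muln1 //; apply: valP.
by rewrite cH => /eqP; rewrite -{2}[#|face X|]muln1 eqn_pmul2l // => /eqP.
Qed.

Lemma lambda_graph_aut : H \subset graph_aut fg.
Proof.
apply/subsetP=> h /lambda_imageP[s sA ->].
by apply/graph_autP=> [|F G]; [apply: face_graph_sym | apply: lambda_adj].
Qed.

(** * Arc colours and the vertices opposite to them *)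

Local Notation kappa := (orbit_colouring H).

(** This is the colour c(F, v). *)
Definition opp_colour F v := kappa [set F; across F v].

Lemma kappa_lambda s F G : s \in Aut -> kappa [set lam s F; lam s G] = kappa [set F; G].
Proof.
move=> sA; have -> : [set lam s F; lam s G] = ('P^* [set F; G] (lam s))%act.
  by rewrite /= /setact imsetU1 imset_set1.
by apply/orbit_eqP/mem_orbit/lambda_imageP; exists s.
Qed.

Lemma kappa_eq F G F' G' : kappa [set F; G] = kappa [set F'; G'] ->
  exists2 s, s \in Aut &
    lam s F = F' /\ lam s G = G' \/ lam s F = G' /\ lam s G = F'.
Proof.
move/esym/orbit_eqP/orbitP=> [_ /lambda_imageP[s sA ->]].
by rewrite /= /setact imsetU1 imset_set1 => /set2_inj E; exists s.
Qed.

Lemma opp_colour_lambda s F v : s \in Aut -> v \in val F ->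
  opp_colour (lam s F) (s v) = opp_colour F v.
Proof. by move=> sA vF; rewrite /opp_colour -lambda_across // kappa_lambda. Qed.

(** By transitivity every arc can be moved to one at [F]. *)
Lemma colours_face F : transitive_on_faces ->
  kappa @: arcs fg = opp_colour F @: val F.
Proof.
move=> tr; apply/setP=> k; apply/imsetP/imsetP => [[_ /imsetP[[A B]] + ->]|[v vF ->]].
  rewrite inE /= => /adj_across[v vA ->] ->.
  have [s sA <-] := tr A F; exists (s v); first by rewrite mem_lambda.
  by rewrite opp_colour_lambda.
exists [set F; across F v] => //; rewrite mem_arcs ?across_adj //.
exact: face_graph_sym.
Qed.

(** Equivalently, [kappa] is a proper arc colouring of the face graph. *)
Definition rainbow_faces := forall F, {in val F &, injective (opp_colour F)}.

Definition coherent_vertices :=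
  forall v F G, v \in val F -> v \in val G -> opp_colour F v = opp_colour G v.

Lemma three_coloursP : transitive_on_faces ->
  #|orbit 'P^* H @: arcs fg| = 3 <-> rainbow_faces.
Proof.
move=> tr; split=> [c3 F|rb].
  by apply/imset_injP; rewrite -colours_face // card_face -c3.
have [F _] := face_exists.
by rewrite -[3](card_face F) -(card_in_imset (rb F)) -colours_face.
Qed.

(** * Bicoloured cycles and stars *)

(** At each face at [v], the arcs of the star are opposite to the two vertices other than [v];
    coherence makes the excluded colour the same at all these faces. *)
Lemma star_colours F v : transitive_on_faces -> rainbow_faces -> coherent_vertices ->
  v \in val F -> kappa @: star v = (kappa @: arcs fg) :\ opp_colour F v.
Proof.
move=> tr rb co vF; apply/setP=> k; apply/imsetP/idP => [[a aS ->]|].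
  have/starP[A [B [AB vA vB aE]]] := aS.
  have [w wA BE] := adj_across AB; rewrite !inE imset_f ?andbT; last first.
    by move: aS; rewrite inE => /andP[].
  rewrite aE BE (co _ _ _ vF vA) (inj_in_eq (rb A)) //.
  by apply: contraTneq vB => <-; rewrite BE across_notin.
rewrite (colours_face F tr) => /setD1P[+ /imsetP[w wF kE]].
rewrite kE => nwv; exists [set F; across F w] => //.
by rewrite star_across //; apply: contraNneq nwv => ->.
Qed.

(** Consecutive arcs of the cycle are distinct arcs at a common face, so [rainbow_faces] separates
    their colours. *)
Lemma star_bicoloured v u : transitive_on_faces -> rainbow_faces -> coherent_vertices ->
  v \in vertices X -> is_cycle fg u -> cycle_arcs u = star v -> bicoloured kappa u.
Proof.
move=> tr rb co vX cu E; have /and3P[cy Uu _] := cu; apply/andP; split.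
  have [F vF] := vertex_face vX.
  rewrite E (star_colours tr rb co vF).
  have c3 : #|kappa @: arcs fg| = 3 by apply/three_coloursP.
  have := cardsD1 (opp_colour F v) (kappa @: arcs fg).
  by rewrite c3 (colours_face F tr) imset_f // add1n => -[<-].
rewrite cycle_map; have := cycle_next Uu.
apply: (@sub_in_cycle _ (mem u)); last exact/allP.
move=> F G Fu Gu /eqP nF.
have FG : fg G F by rewrite -nF face_graph_sym; apply: next_cycle.
have nGn : next u G != F by rewrite -[F](prev_next Uu) nF; apply: next_neq_prev cu Gu.
rewrite /= nF [[set F; G]]setUC.
have [a aG Fa] := adj_across FG; have [b bG nb] := adj_across (next_cycle cy Gu).
rewrite nb Fa (inj_in_eq (rb G)) //.
by apply: contraNneq nGn => ab; rewrite nb Fa ab.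
Qed.

(* The vertex of each face opposite to the arc of the missing colour is the same
   all along a bicoloured cycle. *)
Lemma bicoloured_star u : transitive_on_faces -> rainbow_faces -> coherent_vertices ->
  is_cycle fg u -> bicoloured kappa u -> exists2 v, v \in vertices X & cycle_arcs u = star v.
Proof.
move=> tr rb co cu /andP[/eqP c2 _]; have /and3P[cy Uu _] := cu.
have [F0 F0u] : exists F0, F0 \in u by case: u cu {c2 cy Uu} => [|F0 ?] //; exists F0; rewrite mem_head.
(* The three colours at [F0] cannot all occur among the two colours of the cycle. *)
have [v vF0 vmiss] : exists2 v, v \in val F0 & opp_colour F0 v \notin kappa @: cycle_arcs u.
  have [/exists_inP//|] := boolP [exists v in val F0, opp_colour F0 v \notin kappa @: cycle_arcs u].
  rewrite negb_exists_in => /forall_inP hit.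
  have : opp_colour F0 @: val F0 \subset kappa @: cycle_arcs u.
    by apply/subsetP=> _ /imsetP[v vF ->]; have := hit _ vF; rewrite negbK.
  by move/subset_leq_card; rewrite c2 card_in_imset ?card_face //; apply: rb.
exists v; first exact: face_vertex vF0.
apply: cycle_arcs_star (face_vertex vF0) cu _ => F.
rewrite -(fconnect_cycle (cycle_next Uu) F0u) => /iter_findex<-.
elim: (findex _ _ _) => //= n vF; set F' := iter _ _ _ in vF *.
have F'u : F' \in u by rewrite -(fconnect_cycle (cycle_next Uu) F0u) fconnect_iter.
have [w wF' E] := adj_across (next_cycle cy F'u).
(* Leaving [F'] opposite to [v] would use the missing colour, so [v] survives in the next face. *)
rewrite E across_in //; apply: contraNneq vmiss => vw.
rewrite (co _ _ _ vF0 vF) vw /opp_colour -E; apply: imset_f.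
by apply/mem_cycle_arcsP; left.
Qed.

Lemma cover31_stars : transitive_on_faces -> rainbow_faces -> coherent_vertices ->
  cover31 fg H = [set star v | v in vertices X].
Proof.
move=> tr rb co; apply/setP=> c; apply/bicoloured_cyclesP/imsetP.
  by case=> u [cu bu ->]; have [v vX E] := bicoloured_star tr rb co cu bu; exists v.
case=> v vX ->; have [u umb] : exists u, umbrella v u by case: hX => _ _ _ uX _; apply: uX.
have cu := umbrella_is_cycle vX umb.
have E : cycle_arcs u = star v.
  by apply: cycle_arcs_star => // F; rewrite (mem_umbrella _ umb).
by exists u; split=> //; apply: star_bicoloured E.
Qed.

(* The colour opposite to [v] is the one missing on the arcs around [v]. *)
Lemma cover31_coherent : transitive_on_faces -> rainbow_faces ->
  cover31 fg H = vertex_defining_cycles X -> coherent_vertices.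
Proof.
move=> tr rb E v F G vF vG.
have : star v \in cover31 fg H.
  by rewrite E vertex_defining_cycles_star imset_f // (face_vertex vF).
case/bicoloured_cyclesP=> u [_ /andP[/eqP c2 _] sE]; rewrite -sE in c2.
(* At the face [A] alone, the arcs of the star show both colours other than the one opposite to [v];
   as the star has only two colours, equality follows. *)
have miss (A : face X) : v \in val A -> kappa @: star v = (kappa @: arcs fg) :\ opp_colour A v.
  move=> vA; rewrite (colours_face A tr); apply/esym/eqP; rewrite eqEcard; apply/andP; split.
    apply/subsetP=> k /setD1P[+ /imsetP[w wA kE]]; rewrite kE => nwv.
    by apply: imset_f; rewrite star_across //; apply: contraNneq nwv => ->.
  have := cardsD1 (opp_colour A v) (opp_colour A @: val A).
  by rewrite imset_f // c2 card_in_imset ?card_face ?add1n => [[<-]|]; last exact: rb.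
have cF : opp_colour F v \in kappa @: arcs fg by rewrite (colours_face F tr) imset_f.
apply/eqP/negPn/negP=> nFG.
have : opp_colour F v \in kappa @: star v by rewrite (miss G vG) in_setD1 nFG.
by rewrite (miss F vF) in_setD1 eqxx.
Qed.

(** * Vertex orbits compared with arc colours *)

Local Notation vtype := (orbit 'P Aut).

Lemma vtype_lambda s v : s \in Aut -> vtype (s v) = vtype v.
Proof. by move=> sA; apply/orbit_eqP/(mem_orbit 'P). Qed.

Lemma vtypes_face F : transitive_on_faces -> vtype @: vertices X = vtype @: val F.
Proof.
move=> tr; apply/setP=> k; apply/imsetP/imsetP => [[v /vertex_face[G vG] ->]|[v vF ->]].
  by have [s sA <-] := tr G F; exists (s v); rewrite ?mem_lambda ?vtype_lambda.
by exists v => //; apply: face_vertex vF.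
Qed.

Lemma three_vtypesP : transitive_on_faces ->
  #|vtype @: vertices X| = 3 <-> forall F, {in val F &, injective vtype}.
Proof.
move=> tr; split=> [c3 F|inj].
  by apply/imset_injP; rewrite -vtypes_face // card_face c3.
have [F _] := face_exists.
by rewrite -[3](card_face F) -(card_in_imset (inj F)) -vtypes_face.
Qed.

(** Both faces meet each of the three vertex orbits once and share the vertices other than [v], so
    the remaining vertex of the neighbour is in the orbit of [v]. *)
Lemma vtype_across F v w : transitive_on_faces -> #|vtype @: vertices X| = 3 ->
  v \in val F -> w \in val (across F v) -> w \notin val F -> vtype w = vtype v.
Proof.
move=> tr c3 vF wG wF; have inj := (three_vtypesP tr).1 c3.
have : vtype w \in vtype @: val F.
  by rewrite -vtypes_face // imset_f // (face_vertex wG).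
case/imsetP=> x xF E; rewrite E; congr vtype; apply/eqP/negPn/negP=> nxv.
have xG : x \in val (across F v) by rewrite across_in.
by move: wF; rewrite (inj _ _ _ wG xG E) xF.
Qed.

(** An automorphism matching the arcs matches the opposite vertices up to orbit. Conversely, one
    taking [F] to [G] sends [v] to [w] if their orbits agree, since a face meets each orbit once. *)
Lemma opp_colour_vtype F G v w : transitive_on_faces -> #|vtype @: vertices X| = 3 ->
  v \in val F -> w \in val G -> (opp_colour F v == opp_colour G w) = (vtype v == vtype w).
Proof.
move=> tr c3 vF wG; have inj := (three_vtypesP tr).1 c3.
apply/eqP/eqP => [/kappa_eq[s sA [[sF sG]|[sF sG]]]|E].
- have svG : s v \in val G by rewrite -sF mem_lambda.
  rewrite -(vtype_lambda v sA); congr vtype; apply: (across_inj svG wG).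
  by rewrite -sG lambda_across // sF.
(* Here the ends are exchanged: [s v] is the vertex of [across G w] outside [G]. *)
- rewrite -(vtype_lambda v sA); apply: (vtype_across tr c3 wG).
    by rewrite -sF mem_lambda.
  by rewrite -sG mem_lambda // across_notin.
have [s sA sF] := tr F G; have svG : s v \in val G by rewrite -sF mem_lambda.
rewrite -(opp_colour_lambda sA vF) sF; congr opp_colour.
by apply: (inj G) => //; rewrite vtype_lambda.
Qed.

Lemma three_vtypes_colouring : transitive_on_faces ->
  #|vtype @: vertices X| = 3 <-> rainbow_faces /\ coherent_vertices.
Proof.
move=> tr; split=> [c3|[rb co]].
  have inj := (three_vtypesP tr).1 c3; split=> [F v w vF wF /eqP|v F G vF vG].
    by rewrite opp_colour_vtype // => /eqP; apply: (inj F).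
  by apply/eqP; rewrite opp_colour_vtype.
apply/three_vtypesP=> // F v w vF wF /esym/orbit_eqP/orbitP[s sA sv].
(* By coherence [w = s v] has the same opposite colour at [F] as at [lam s F], where it is the
   colour opposite to [v] at [F]. *)
have wsF : w \in val (lam s F) by rewrite -sv mem_lambda.
by apply: (rb F) => //; rewrite (co _ _ _ wF wsF) -sv opp_colour_lambda.
Qed.

(** * The equivalence *)

(** Given transitivity, face stabilisers of order one amount to [#|H| = #|face X|], and three vertex
    orbits to the two colour conditions, the first of which says that there are three arc orbits. *)
Lemma vf31_group31 :
  (face_transitive X /\ has_vf X 3 1) <->
  (group31 fg H /\ cover31 fg H = vertex_defining_cycles X).
Proof.
split=> [[/face_transitiveP tr [c3 st]]|[[_ _ [/lambda_transitiveP tr cH] c3 _] E]].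
  have [rb co] := (three_vtypes_colouring tr).1 c3.
  have cE := cover31_stars tr rb co.
  have Htr := lambda_transitiveP.2 tr.
  split; last by rewrite cE vertex_defining_cycles_star.
  split.
  - split; [exact: face_graph_simple | exact: face_graph_cubic |].
    rewrite /node_transitive (atrans_supgroup lambda_graph_aut Htr).
    by apply/subsetP=> h _; rewrite !inE; apply/subsetP=> F; rewrite !inE.
  - exact: lambda_graph_aut.
  - by split=> //; apply/stabilisers_trivialP.
  - exact/three_coloursP.
  - by rewrite cE; split; [apply: stars_double_cover | apply: stars_vertex_faithful].
have rb := (three_coloursP tr).1 c3.
split; first exact/face_transitiveP.
split; last exact/stabilisers_trivialP.
by apply/three_vtypes_colouring => //; split=> //; apply: cover31_coherent.
Qed.

End Surface.

Theorem theorem4p5 (P : finType) (X : {set {set P}}) (hX : simplicial_surface X) :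
  (face_transitive X /\ has_vf X 3 1) <->
  (let H := (lambda X @* aut_complex X)%G in
   group31 (face_graph X) H /\
   cover31 (face_graph X) H = vertex_defining_cycles X).
Proof. exact: vf31_group31. Qed.
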